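(* There is a family $\{f_\alpha\in\omega^\omega:\alpha<\mathfrak{c}\}$, where $\mathfrak{c}=2^{\aleph_0}$ and $\limsup_n f_\alpha(n)=\infty$ for each $\alpha$, such that for all $\alpha\neq\beta$ either $f\mathcal{N}(f_\alpha)\subsetneq f\mathcal{N}(f_\beta)$ or $f\mathcal{N}(f_\beta)\subsetneq f\mathcal{N}(f_\alpha)$.
   Context: For $\sigma\in\omega^{<\omega}$, $[\sigma]=\{x\in\omega^\omega:\sigma\subseteq x\}$ and $|\sigma|$ is the length of $\sigma$. For $h\in\omega^\omega$ with $\limsup_n h(n)=\infty$, a set $F\subseteq\omega^\omega$ belongs to $f\mathcal{N}(h)$ if for every $\varepsilon>0$ there is a sequence $(\sigma_n)_{n\in\omega}$ in $\omega^{<\omega}$ with $\sum_{n\in\omega}\frac{1}{h(|\sigma_n|)}<\varepsilon$ and $F\subseteq\bigcup_{n\in\omega}[\sigma_n]$. Convention: $1/0=\infty$. *)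

(* Defs.v *)
From mathcomp Require Import all_boot all_order all_algebra.
From mathcomp Require Import all_classical all_reals all_analysis.

Set Implicit Arguments.
Unset Strict Implicit.
Unset Printing Implicit Defensive.

Import Order.TTheory GRing.Theory Num.Theory.

Local Open Scope classical_set_scope.
Local Open Scope ring_scope.

Definition cylinder (s : seq nat) : set (nat -> nat) :=
  [set x | forall i, (i < size s)%N -> nth 0%N s i = x i].

Definition limsup_infty (R : realType) (h : nat -> nat) : Prop :=
  limn_esup (fun n => ((h n)%:R : R)%:E) = +oo%E.

(* The inverse is the one of the extended reals, for which 0^-1 = +oo. *)
Definition weight (R : realType) (h : nat -> nat) (s : seq nat) : \bar R :=
  (((h (size s))%:R : R)%:E^-1)%E.

Definition fN (R : realType) (h : nat -> nat) : set (set (nat -> nat)) :=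
  [set F | forall e : R, 0 < e ->
     exists s : nat -> seq nat,
       (\sum_(0 <= n <oo) weight R h (s n) < e%:E)%E /\
       F `<=` \bigcup_n cylinder (s n)].

(* Main.v *)
Require Import Defs.
From mathcomp Require Import all_boot all_order all_algebra.
From mathcomp Require Import all_classical all_reals all_analysis.
From mathcomp Require Import lra.

(** For a sequence [b] of branching numbers let [box b] be the product of the
    finite sets [{0, .., b i - 1}], and let [level b n = b 0 * .. * b (n - 1)]
    count its restrictions to length [n].

    The box is not in [fN (level b)].  Giving the cylinder of [t] the mass
    [1 / level b (size t)] is the uniform probability on [box b], so cylinders
    of total weight less than 1 cannot cover it.  No measure is built: as the
    weight of a node is the sum of the weights of its children, a node that
    weighs more than the cylinders below it has a child with the same property
    ([light_child]), and such children traced from the root give a point of the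
    box outside all the cylinders ([box_notin_fN]).  On the other hand
    [box b] is in [fN g] as soon as [g / level b] is unbounded: cover it by its
    [level b n] cylinders of length [n] for a suitable [n] ([box_in_fN]).  So
    if [b <= c] everywhere and [2 * b <= c] from some point on, then
    [fN (level b)] is a proper subset of [fN (level c)]
    ([fN_level_proper]).

    It remains to find continuum many branching sequences, any two of which are
    related in this way.  For [a : nat -> bool] take [b i = 2 ^ v_i], where
    [v_i] is the number with binary digits [1 a_0 .. a_(i-1)].  Two different
    sequences of digits first differ somewhere; there the corresponding numbers
    become different, and they keep the same strict order from then on
    ([bits_lt], [bits_le]). *)

Set Implicit Arguments.
Unset Strict Implicit.
Unset Printing Implicit Defensive.

Import Order.TTheory GRing.Theory Num.Theory.

Local Open Scope classical_set_scope.

(** * Weights and finite covers *)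

Lemma weight_ge0 (R : realType) (h : nat -> nat) t : (0 <= weight R h t)%E.
Proof. by rewrite inve_ge0 lee_fin ler0n. Qed.

Lemma weightE (R : realType) (h : nat -> nat) t :
  0 < h (size t) -> weight R h t = ((h (size t))%:R^-1)%:E%R.
Proof. by rewrite /weight inver pnatr_eq0 lt0n => /negbTE ->. Qed.

Lemma weight_anti (R : realType) (h g : nat -> nat) t :
  h (size t) <= g (size t) -> (weight R g t <= weight R h t)%E.
Proof.
by move=> hg; rewrite /weight lee_pV2 ?inE ?lee_fin ?ler0n // ler_nat.
Qed.

Lemma fN_subset (R : realType) (h g : nat -> nat) :
  (forall n, h n <= g n) -> fN R h `<=` fN R g.
Proof.
move=> hg F FN e /FN [s [se Fs]]; exists s; split=> //.
apply: le_lt_trans se; apply: lee_nneseries => [i _ _|i _].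
  exact: weight_ge0.
exact: weight_anti.
Qed.

Lemma exists_light_string (R : realType) (g : nat -> nat) (e : R) :
  (forall K, exists n, K <= g n) -> (0 < e)%R ->
  exists t, (weight R g t <= e%:E)%E.
Proof.
move=> g_unbounded e0.
have [n gn] := g_unbounded (Num.truncn (e^-1)%R).+1.
exists (nseq n 0); rewrite weightE size_nseq; last exact: leq_trans gn.
rewrite lee_fin invf_ple ?posrE ?ltr0n //; last exact: leq_trans gn.
by rewrite (le_trans (ltW (truncnS_gt _))) // ler_nat.
Qed.

(** The definition of [fN] asks for an infinite sequence of strings, so a finite
    cover has to be continued by strings of arbitrarily small total weight. *)
Lemma finite_cover (R : realType) (g : nat -> nat) (F : set (nat -> nat))
    (L : seq (seq nat)) (d c : R) :
  (forall K, exists n, K <= g n) -> (0 < c)%R ->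
  (forall x, F x -> exists2 t, t \in L & cylinder t x) ->
  (\sum_(t <- L) weight R g t <= d%:E)%E ->
  exists s : nat -> seq nat,
    (\sum_(0 <= n <oo) weight R g (s n) <= (d + c)%:E)%E /\
    F `<=` \bigcup_n cylinder (s n).
Proof.
move=> g_unbounded c0 FL Ld.
have /choice [pad padP] k :
    exists t, (weight R g t <= (c / (2 ^ k.+1)%:R)%:E)%E.
  by apply: exists_light_string => //; rewrite divr_gt0 // ltr0n expn_gt0.
exists (fun k => if k < size L then nth [::] L k else pad k); split; last first.
  move=> x /FL [t tL tx]; exists (index t L) => //.
  by rewrite index_mem tL nth_index.
pose A k := if k < size L then weight R g (nth [::] L k) else 0%E.
have A0 k : (0 <= A k)%E by rewrite /A; case: ifP => // _; exact: weight_ge0.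
have -> : (d + c)%:E%R = (d%:E + c%:E)%E by [].
apply: (@le_trans _ _ (\sum_(0 <= k <oo) A k + c%:E)%E); last first.
  rewrite leeD2r // (nneseries_split 0 (size L)) // [X in (_ + X)%E]eseries0.
    rewrite adde0; apply: le_trans Ld; rewrite (big_nth [::]) /= add0n.
    by rewrite big_nat [leRHS]big_nat; apply: lee_sum => k /= kL; rewrite /A kL.
  by move=> k; rewrite add0n /A leqNgt; case: ltnP.
apply: le_trans (epsilon_trick _ A0 (ltW c0)).
apply: lee_nneseries => [k _ _|k _]; first exact: weight_ge0.
rewrite /A; case: ifP => _; last by rewrite add0e.
by rewrite leeDl // lee_fin divr_ge0 // ltW.
Qed.

(** * Boxes *)

Definition box (b : nat -> nat) : set (nat -> nat) :=
  [set x | forall i, x i < b i].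

Definition level (b : nat -> nat) (n : nat) : nat := \prod_(i < n) b i.

Lemma levelS b n : level b n.+1 = level b n * b n.
Proof. by rewrite /level big_ord_recr. Qed.

Lemma level_gt0 b n : (forall i, 0 < b i) -> 0 < level b n.
Proof. by move=> b0; rewrite prodn_gt0. Qed.

Fixpoint box_strings (b : nat -> nat) (n : nat) : seq (seq nat) :=
  if n is m.+1 then [seq rcons t j | t <- box_strings b m, j <- iota 0 (b m)]
  else [:: [::]].

Lemma size_box_strings b n : size (box_strings b n) = level b n.
Proof.
elim: n => [|n IHn] /=; first by rewrite /level big_ord0.
by rewrite size_allpairs size_iota IHn levelS.
Qed.

Lemma size_mem_box_strings b n t : t \in box_strings b n -> size t = n.
Proof.
elim: n t => [|n IHn] t /=; first by rewrite inE => /eqP ->.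
by case/allpairsP=> -[u j] /= [/IHn un _ ->]; rewrite size_rcons un.
Qed.

Lemma mkseq_box_strings b x n : box b x -> mkseq x n \in box_strings b n.
Proof.
move=> bx; elim: n => [//|n IHn]; rewrite mkseqS /=.
by apply: allpairs_f => //; rewrite mem_iota add0n leq0n bx.
Qed.

Lemma cylinder_mkseq x n : cylinder (mkseq x n) x.
Proof. by move=> i; rewrite size_mkseq => i_n; rewrite nth_mkseq. Qed.

Lemma cylinderE t x : cylinder t x -> t = mkseq x (size t).
Proof.
move=> tx; apply: (@eq_from_nth _ 0) => [|i i_t]; first by rewrite size_mkseq.
by rewrite tx // nth_mkseq.
Qed.

(** The [level b n] cylinders of length [n] that cover the box have total weight
    [level b n / g n], which a suitable choice of [n] makes small. *)
Lemma box_in_fN (R : realType) (b g : nat -> nat) :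
  (forall i, 0 < b i) ->
  (forall K, exists n, K * level b n <= g n) -> fN R g (box b).
Proof.
move=> b0 g_large e e0.
have g_unbounded K : exists n, K <= g n.
  have [n gn] := g_large K; exists n; apply: leq_trans gn.
  by rewrite leq_pmulr // level_gt0.
have e3 : (0 < e / 3%:R)%R by rewrite divr_gt0.
have [n gn] := g_large (Num.truncn ((e / 3%:R)^-1)%R).+1.
have [||s [se Fs]] := @finite_cover R g (box b) (box_strings b n)
    (e / 3%:R)%R (e / 3%:R)%R g_unbounded e3.
- move=> x bx; exists (mkseq x n); first exact: mkseq_box_strings.
  exact: cylinder_mkseq.
- have gn0 : 0 < g n by apply: leq_trans gn; rewrite muln_gt0 level_gt0.
  rewrite (eq_big_seq (fun=> ((g n)%:R^-1)%:E%R)); last first.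
    by move=> t /size_mem_box_strings tn; rewrite weightE tn.
  rewrite sumEFin big_const_seq count_predT size_box_strings iter_addr_0.
  rewrite lee_fin -[leLHS]mulr_natl ler_pdivrMr ?ltr0n //.
  move: gn; rewrite -ler_pdivrMl // -(ler_nat R) natrM; apply: le_trans.
  by apply: ler_wpM2r => //; apply: ltW; exact: truncnS_gt.
exists s; split=> //; apply: le_lt_trans se _; by rewrite lte_fin; lra.
Qed.

(** * The mass argument *)

(** For [h = level b] this bounds the measure that the strings of [s] extending
    [t] can cover inside the cylinder of [t], whose own measure is the weight of
    [t].  A node with [mass < weight] is therefore not exhausted by them; in
    particular it is not one of the strings of [s] ([weight_le_mass]). *)
Definition mass (R : realType) (h : nat -> nat) (s : nat -> seq nat)
    (t : seq nat) : \bar R :=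
  (\sum_(0 <= n <oo) (if prefix t (s n) then weight R h (s n) else 0))%E.

Lemma mass_term_ge0 (R : realType) (h : nat -> nat) s t (n : nat) :
  (0 <= if prefix t (s n) then weight R h (s n) else 0)%E.
Proof. by case: ifP => // _; exact: weight_ge0. Qed.

Lemma weight_le_mass (R : realType) (h : nat -> nat) s n :
  (weight R h (s n) <= mass R h s (s n))%E.
Proof.
apply: le_trans (nneseries_lim_ge n.+1 _); last first.
  by move=> k _ _; exact: mass_term_ge0.
rewrite big_nat_recr //= prefix_refl leeDr //.
by apply: sume_ge0 => k _; exact: mass_term_ge0.
Qed.

(** A string that extends [t] extends at most one child of [t].  The inequality
    can be strict: strings equal to [t] or continuing it by a number [>= m] are
    not counted on the left. *)
Lemma mass_children (R : realType) (h : nat -> nat) s (t : seq nat) m :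
  (\sum_(j < m) mass R h s (rcons t j) <= mass R h s t)%E.
Proof.
rewrite -nneseries_sum => [|j n _]; last exact: mass_term_ge0.
apply: lee_nneseries => [n _ _|n _].
  by apply: sume_ge0 => j _; exact: mass_term_ge0.
case: ifP => [/prefixP [u ->]|tn]; last first.
  rewrite big1 // => j _; case: ifP => // /(prefix_trans (prefix_rcons t j)).
  by rewrite tn.
under eq_bigr => j _ do rewrite -cats1 prefix_catr // eqxx /=.
case: u => [|k u] /=; first by rewrite big1 // weight_ge0.
under eq_bigr => j _ do rewrite prefix0s andbT.
rewrite -big_mkcond /=; have [km|mk] := ltnP k m.
  by rewrite (big_pred1 (Ordinal km)).
rewrite big_pred0 ?weight_ge0 // => j; apply: contraTF (ltn_ord j).
by rewrite -leqNgt => /eqP ->.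
Qed.

Lemma weight_children (R : realType) (b : nat -> nat) (t : seq nat) :
  (forall i, 0 < b i) ->
  (\sum_(j < b (size t)) weight R (level b) (rcons t j) =
   weight R (level b) t)%E.
Proof.
move=> b0; have l0 n := level_gt0 n b0.
under eq_bigr => j _ do rewrite weightE // size_rcons.
rewrite sumEFin sumr_const card_ord weightE // levelS natrM invfM.
by rewrite -mulrnAr -[(_ *+ b _)%R]mulr_natr mulVf ?mulr1 // pnatr_eq0 -lt0n.
Qed.

(** Mass is superadditive and weight additive over the children, so it is
    impossible that every child has at least as much mass as weight. *)
Lemma light_child (R : realType) (b : nat -> nat) s t :
  (forall i, 0 < b i) ->
  (mass R (level b) s t < weight R (level b) t)%E ->
  exists2 j, j < b (size t) &
    (mass R (level b) s (rcons t j) < weight R (level b) (rcons t j))%E.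
Proof.
move=> b0; rewrite ltNge => light; apply: contrapT => no_child.
move/negP: light; apply; apply: le_trans (mass_children _ _ _ _ (b (size t))).
rewrite -weight_children //; apply: lee_sum => j _; rewrite leNgt.
by apply/negP => jlight; apply: no_child; exists j.
Qed.

Lemma box_notin_fN (R : realType) (b : nat -> nat) :
  (forall i, 0 < b i) -> ~ fN R (level b) (box b).
Proof.
move=> b0 /(_ 1%R ltr01) [s [s1 box_s]].
pose light t := (mass R (level b) s t < weight R (level b) t)%E.
have /choice [next nextP] t :
    exists j, light t -> j < b (size t) /\ light (rcons t j).
  have [/(light_child b0) [j jb jl]|heavy] := pselect (light t).
    by exists j.
  by exists 0.
(* The light nodes traced from the root are the restrictions of the point [x]. *)
pose node n := iter n (fun t => rcons t (next t)) [::].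
pose x n := next (node n).
have nodeE n : node n = mkseq x n by elim: n => //= n {1}->; rewrite mkseqS.
have node_light n : light (node n).
  elim: n => [|n IHn]; last by have [] := nextP _ IHn.
  rewrite /light /mass weightE /level big_ord0 // invr1.
  by under eq_eseriesr do rewrite prefix0s.
have /box_s [n _ /cylinderE sn] : box b x.
  move=> n; have [+ _] := nextP _ (node_light n).
  by rewrite [X in size X]nodeE size_mkseq.
have := node_light (size (s n)).
by rewrite nodeE -sn /light ltNge weight_le_mass.
Qed.

(** * Comparing ideals *)

(** From [k] on the ratio of the two levels at least doubles at every step, so
    it is unbounded and [box b] separates the two ideals. *)
Lemma fN_level_proper (R : realType) (b c : nat -> nat) (k : nat) :
  (forall i, 0 < b i) -> (forall i, b i <= c i) ->
  (forall i, k <= i -> 2 * b i <= c i) ->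
  fN R (level b) `<` fN R (level c).
Proof.
move=> b0 bc bc2; have le_bc n : level b n <= level c n by exact: leq_prod.
split; first exact: fN_subset.
move/(_ (box b)) => cb; apply: (@box_notin_fN R b b0); apply: cb.
(* At [n = k] the ratio of the levels is at least 1. *)
have ratio j : 2 ^ j * level b (j + k) <= level c (j + k).
  elim: j => [|j IHj]; first by rewrite mul1n.
  by rewrite addSn !levelS expnSr mulnACA leq_mul // bc2 // leq_addl.
apply: box_in_fN => // K; exists (K + k); apply: leq_trans (ratio K).
by rewrite leq_mul2r ltnW ?orbT // ltn_expl.
Qed.

Lemma limsup_infty_level (R : realType) (b : nat -> nat) :
  (forall i, 1 < b i) -> limsup_infty R (level b).
Proof.
move=> b2; have pow_le n : 2 ^ n <= level b n.
  elim: n => [|n IHn]; first by rewrite /level big_ord0.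
  by rewrite levelS expnSr leq_mul.
apply: (cvg_limn_einf_sup _).2; apply/cvgenyP.
apply/cvgnyPge => K; near=> n.
apply: (@leq_trans n); first by near: n; exact: nbhs_infty_ge.
exact: leq_trans (ltnW (ltn_expl n (isT : 1 < 2))) (pow_le n).
Unshelve. all: by end_near. Qed.

(** * Binary expansions *)

(** The leading digit 1 makes the values positive, which keeps every branching
    number [2 ^ bits a n] above 1. *)
Fixpoint bits (a : nat -> bool) (n : nat) : nat :=
  if n is m.+1 then (bits a m).*2 + a m else 1.

Lemma bits_gt0 a n : 0 < bits a n.
Proof. by elim: n => //= n IHn; rewrite addn_gt0 double_gt0 IHn. Qed.

(** A lead of 1 becomes a lead of 2 after doubling, and the next digits can
    take back at most 1. *)
Lemma bits_lt a a' m n : bits a m < bits a' m -> m <= n -> bits a n < bits a' n.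
Proof.
move=> lt_m /subnK <-; elim: (n - m) => [//|d IHd] /=.
apply: (@leq_trans (bits a (d + m)).+1.*2).
  by rewrite doubleS ltnS -[leqRHS]addn1 leq_add2l; case: (a _).
by apply: leq_trans (leq_addr _ _); rewrite leq_double.
Qed.

Lemma bits_le a a' m n : bits a m < bits a' m -> bits a n <= bits a' n.
Proof.
move=> lt_m; rewrite leqNgt; apply/negP => lt_n.
have := bits_lt lt_m (leq_maxl m n).
by rewrite ltnNge ltnW // (bits_lt lt_n) // leq_maxr.
Qed.

Lemma bits_neq a a' : a <> a' -> exists m, bits a m != bits a' m.
Proof.
move=> aa'; apply: contrapT => all_eq; apply: aa'.
have E m : bits a m = bits a' m.
  by apply/eqP/negPn/negP => ne; apply: all_eq; exists m.
apply/funext => m; have /= := E m.+1; rewrite E => /addnI.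
by case: (a m); case: (a' m).
Qed.

Lemma fN_bits_proper (R : realType) a a' m : bits a m < bits a' m ->
  fN R (level (fun i => 2 ^ bits a i)) `<` fN R (level (fun i => 2 ^ bits a' i)).
Proof.
move=> lt_m; apply: (@fN_level_proper R _ _ m) => i; first by rewrite expn_gt0.
- by rewrite leq_exp2l // (bits_le _ lt_m).
- by move=> mi; rewrite -expnS leq_exp2l // (bits_lt lt_m mi).
Qed.

Local Open Scope card_scope.

(* MathComp world. I is any index set of cardinality continuum, in particular
   the set of ordinals below the continuum. *)
Theorem corollary33 (R : realType) (I : Type)
    (cardI : [set: I] #= [set: nat -> bool]) :
  exists f : I -> nat -> nat,
    (forall a : I, limsup_infty R (f a)) /\
    (forall a b : I, a <> b ->
       fN R (f a) `<` fN R (f b) \/ fN R (f b) `<` fN R (f a)).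
Proof.
have [digits digits_inj] : exists digits : I -> nat -> bool, injective digits.
  move/card_eqPle: cardI => [/card_leP [d] _].
  exists (fun a => val (d (SigSub (in_setT a)))).
  move=> a b /val_inj /inj /= ab.
  by have /(congr1 val) := ab (in_setT _) (in_setT _).
exists (fun a => level (fun i => 2 ^ bits (digits a) i)); split=> [a|a b ab].
  apply: limsup_infty_level => i.
  by rewrite -[1]/(2 ^ 0) ltn_exp2l // bits_gt0.
have /bits_neq [m] : digits a <> digits b by move/digits_inj.
by rewrite neq_ltn => /orP [] lt_m; [left | right]; exact: fN_bits_proper lt_m.
Qed.
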